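(* Let $V=(v_n)_{n=1}^\infty$ be a normalized basic sequence and let $X$ be a Banach space. Then $X$ has property $(S_V)$ if and only if $X$ has property $(U_V)$.
   Context: Banach spaces are real, and $c_{00}$ denotes the space of finitely supported real sequences. A basic sequence $(v_n)$ is a sequence in some Banach space that is a Schauder basis of its closed linear span; it is normalized if $\|v_n\|=1$ for all $n$. For $C<\infty$, a sequence $(y_n)$ in a Banach space has a $C$-upper $V$-estimate (equivalently, $V$ $C$-dominates $(y_n)$) if $$\Big\|\sum_{n=1}^\infty \alpha_n y_n\Big\|\le C\quad\text{for all }(\alpha_n)\in c_{00}\text{ with }\Big\|\sum_{n=1}^\infty\alpha_n v_n\Big\|\le 1 .$$ $X$ has property $(S_V)$ if every normalized weakly null sequence in $X$ has a subsequence which has a $C$-upper $V$-estimate for some constant $C<\infty$ ($C$ may depend on the sequence). $X$ has property $(U_V)$ if $C$ may be chosen uniformly, i.e. there is a single constant $C<\infty$ such that every normalized weakly null sequence in $X$ has a subsequence with a $C$-upper $V$-estimate. *)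

(* Defs.v *)
From mathcomp Require Import all_boot all_order all_algebra.
From mathcomp Require Import all_classical all_reals all_analysis.
Import Order.TTheory GRing.Theory Num.Theory.
Import numFieldNormedType.Exports.

Set Implicit Arguments.
Unset Strict Implicit.
Unset Printing Implicit Defensive.

Local Open Scope classical_set_scope.
Local Open Scope ring_scope.

Definition c00 (R : realType) : set (R^nat) :=
  [set a | finite_set (a @^-1` [set~ 0])].
Arguments c00 : clear implicits.

(* Meant for [a] in [c00 R]: a [\sum_(_ \in _)] without finite support is 0
   by convention.  Sequences are indexed from 0. *)
Definition lincomb (R : realType) (E : normedModType R) (a : R^nat) (u : E^nat)
    : E :=
  \sum_(n \in [set: nat]) a n *: u n.

Definition closed_span (R : realType) (E : normedModType R) (u : E^nat)
    : set E :=
  closure [set lincomb a u | a in c00 R].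

Definition schauder_basis (R : realType) (E : normedModType R) (Y : set E)
    (u : E^nat) : Prop :=
  (forall n, Y (u n)) /\
  (forall y, Y y ->
    exists! a : R^nat, series (fun n => a n *: u n) @ \oo --> y).

Definition basic_sequence (R : realType) (E : normedModType R) (u : E^nat)
    : Prop :=
  schauder_basis (closed_span u) u.

Definition normalized (R : realType) (E : normedModType R) (u : E^nat) : Prop :=
  forall n, `|u n| = 1.

Definition weakly_null (R : realType) (E : normedModType R) (u : E^nat)
    : Prop :=
  forall f : {linear E -> R^o}, continuous f -> f \o u @ \oo --> (0 : R^o).

Definition upper_estimate (R : realType) (W E : normedModType R) (v : W^nat)
    (C : R) (y : E^nat) : Prop :=
  forall a, c00 R a -> `|lincomb a v| <= 1 -> `|lincomb a y| <= C.

Definition property_S (R : realType) (W E : normedModType R) (v : W^nat)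
    : Prop :=
  forall x : E^nat, normalized x -> weakly_null x ->
    exists f : nat -> nat,
      increasing_seq f /\ exists C : R, upper_estimate v C (x \o f).

Definition property_U (R : realType) (W E : normedModType R) (v : W^nat)
    : Prop :=
  exists C : R, forall x : E^nat, normalized x -> weakly_null x ->
    exists f : nat -> nat, increasing_seq f /\ upper_estimate v C (x \o f).

Arguments property_S {R W} E v.
Arguments property_U {R W} E v.

(* Main.v *)
Require Import Defs.
From mathcomp Require Import all_boot all_order all_algebra.
From mathcomp Require Import all_classical all_reals all_analysis.
From mathcomp Require Import ring lra.
Import numFieldNormedType.Exports.
Import Order.TTheory GRing.Theory Num.Theory.

Set Implicit Arguments.
Unset Strict Implicit.
Unset Printing Implicit Defensive.

Local Open Scope classical_set_scope.
Local Open Scope ring_scope.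

(** Fix a free ultrafilter on the natural numbers and call a set of
    subsequences large when it contains all branches of a tree in which every node has
    ultrafilter-many successors.  For a bounded weakly null sequence y let N(y)
    be the infimum of the C such that the set of subsequences of y with a
    C-upper V-estimate is large.  Largeness is stable under intersections,
    and closed sets of subsequences are determined, so N is a seminorm
    and (S_V) forces N to be finite everywhere.  Since trees can be diagonalised
    at the cost of finitely many initial terms, N is moreover countably
    subadditive along rapidly converging series.  Zabreiko's lemma (a Baire
    category argument that needs no continuity) then bounds N on the unit ball
    of the Banach space of bounded weakly null sequences, which is (U_V).
    The same lemma bounds the coordinate functionals of V. *)

(** * Bounded seminorms on Banach spaces *)

Lemma choice2 (A B C : Type) (P : A -> B -> C -> Prop) :
  (forall a b, exists c, P a b c) -> exists f, forall a b, P a b (f a b).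
Proof.
move=> H; have [f fP] := choice (fun p : A * B => H p.1 p.2).
by exists (fun a b => f (a, b)) => a b; exact: fP (a, b).
Qed.

Lemma cauchy_limit (R : realType) (X : completeNormedModType R) (x : X^nat)
    (r : R^nat) : r @ \oo --> (0 : R) ->
  (forall n m, (n <= m)%N -> `|x m - x n| <= r n) ->
  exists l, forall n, `|l - x n| <= r n.
Proof.
move=> r0 xr.
have xc : cvg (x @ \oo).
  apply: cauchy_cvg; apply: cauchy_exP => e e0.
  have /cvgrPdist_lt /(_ e e0) [N _ HN] := r0.
  exists (x N), N => // m /= Nm; rewrite -ball_normE /= distrC.
  apply: le_lt_trans (xr _ _ Nm) _.
  by have := HN N (leqnn N); rewrite /= sub0r normrN; apply: le_lt_trans; exact: ler_norm.
exists (lim (x @ \oo)) => n; apply/ler_addgt0Pr => e e0.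
have /cvgrPdist_lt /(_ e e0) [N _ HN] := xc.
have := HN (maxn N n) (leq_maxl _ _) => /= H.
rewrite -(subrKA (x (maxn N n))) (le_trans (ler_normD _ _)) // addrC lerD //.
  exact: xr (leq_maxr _ _).
exact: ltW.
Qed.

Section zabreiko.
Variables (R : realType) (X : completeNormedModType R) (I : Type).
Variables (Z : set (I -> X)) (G : R -> set (I -> X)).

Hypothesis Z0 : Z 0.
Hypothesis ZB : forall y z, Z y -> Z z -> Z (y - z).
Hypothesis ZZ : forall t y, Z y -> Z (t *: y).
Hypothesis Z_lim : forall (u : (I -> X)^nat) (r : R^nat) y, r @ \oo --> (0 : R) ->
  (forall n, Z (u n)) -> (forall n i, `|y i - u n i| <= r n) -> Z y.
Hypothesis GS : forall C C' y, C <= C' -> G C y -> G C' y.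
Hypothesis GB : forall C C' y z, G C y -> G C' z -> G (C + C') (y - z).
Hypothesis GZ : forall C (t : R) y, 0 < t -> G C y -> G (t * C) (t *: y).
Hypothesis G_finite : forall y, Z y -> exists C, G C y.

(** Sup-norm distance in pointwise form, so that [I -> X] carries no norm; [Z] is a subspace closed
    for it. *)
Let near r (y z : I -> X) := forall i, `|y i - z i| <= r.

Let dense_in m y r := forall z, Z z -> near r z y ->
  forall e : R, 0 < e -> exists2 w, Z w & G m%:R w /\ near e z w.

(** Baire category: otherwise nested balls, the [m]-th step avoiding [G m%:R], shrink to a point of
    [Z] at which [G_finite] fails. *)
Let somewhere_dense : exists m y (r : R), [/\ Z y, 0 < r & dense_in m y r].
Proof.
apply: contrapT => nD.
have /choice2 [next nextP] : forall m (s : (I -> X) * R), exists s' : (I -> X) * R,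
    Z s.1 -> 0 < s.2 ->
    [/\ Z s'.1, 0 < s'.2, s'.2 <= s.2 / 2, near (s.2 / 2) s'.1 s.1 &
        forall w, Z w -> near s'.2 s'.1 w -> ~ G m%:R w].
  move=> m [y r] /=; apply: contrapT => /forallNP nS.
  have [Zy r0] : Z y /\ 0 < r.
    by split; apply: contrapT => nH; apply: (nS (0, 0)).
  (* Density is denied on the ball of half the radius, so the new ball, of radius at most [r / 2],
     stays inside the old one. *)
  apply: nD; exists m, y, (r / 2); split=> //; first by rewrite divr_gt0.
  move=> z Zz zy e e0; apply: contrapT => nw.
  apply: (nS (z, Num.min e (r / 2))) => _ _ /=; split => //.
  - by rewrite lt_min e0 divr_gt0.
  - by rewrite ge_min lexx orbT.
  move=> w Zw zw Gw; apply: nw; exists w => //; split => // i.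
  by apply: le_trans (zw i) _; rewrite ge_min lexx.
pose fix s n := if n is n'.+1 then next n' (s n') else (0, 1).
have sP n : Z (s n).1 /\ 0 < (s n).2.
  by elim: n => [|n [Zn rn]]; [split|have [] := nextP n _ Zn rn].
pose u n := (s n).1; pose r n := (s n).2.
have r0 n : 0 < r n := (sP n).2.
have [Zu stepr stepu avoid] : [/\ forall n, Z (u n), forall n, r n.+1 <= r n / 2,
    forall n, near (r n / 2) (u n.+1) (u n) &
    forall n w, Z w -> near (r n.+1) (u n.+1) w -> ~ G n%:R w].
  by split => [n|n|n|n]; have [Zn rn] := sP n; have [] := nextP n _ Zn rn.
have r_small n : r n <= 2^-1 ^+ n.
  elim: n => [|n IH]; first by rewrite expr0.
  by rewrite exprS (le_trans (stepr n)) // mulrC ler_wpM2l // invr_ge0.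
have r_cvg : r @ \oo --> (0 : R).
  apply: (@squeeze_cvgr _ _ _ _ (fun=> 0) (fun n => 2^-1 ^+ n)).
  - by apply: nearW => n; rewrite ltW //= r_small.
  - exact: cvg_cst.
  - by apply: cvg_expr; rewrite ger0_norm ?invr_ge0// invf_lt1// ltr1n.
(* Since radii at least halve, each step is at most [r m - r m.+1] and the steps telescope: the
   limit stays within [r n] of every [u n]. *)
have uu i n m : (n <= m)%N -> `|u m i - u n i| <= r n - r m.
  elim: m => [|m IH]; first by rewrite leqn0 => /eqP ->; rewrite !subrr normr0.
  rewrite leq_eqVlt => /orP [/eqP ->|]; first by rewrite !subrr normr0.
  rewrite ltnS => /IH nm; rewrite -(subrKA (u m i)) (le_trans (ler_normD _ _)) //.
  have := stepu m i; have := stepr m; rewrite -/(r _) -/(r _) => a b.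
  by lra.
have /choice [y yu] : forall i, exists l, forall n, `|l - u n i| <= r n.
  move=> i; apply: cauchy_limit => // n m /(uu i) h; apply: le_trans h _.
  by rewrite gerBl ltW.
have Zy : Z y by apply: (Z_lim r_cvg Zu) => n i; exact: yu.
have [C GC] := G_finite Zy.
apply: (avoid (Num.bound C) y Zy); first by move=> i; rewrite distrC.
by apply: GS GC; exact/ltW/unstable.ltr_bound.
Qed.

(** Density is moved from the ball about [y] to balls about 0: rescale [z] to size [r], approximate
    both [t *: z + y] and [y] within [r / 8], subtract, and scale back. *)
Let approx : exists2 B, 0 <= B & forall z (rho : R), Z z -> 0 < rho -> near rho z 0 ->
  exists w, [/\ Z w, G (B * rho) w & near (4^-1 * rho) z w].
Proof.
have [m [y [r [Zy r0 D]]]] := somewhere_dense.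
have ZD a b : Z a -> Z b -> Z (a + b).
  by move=> Za Zb; rewrite -[b]opprK -[- b]sub0r; apply/ZB/ZB.
exists ((m%:R + m%:R) / r); first by rewrite divr_ge0 // ?ltW // addr_ge0.
move=> z rho Zz rho0 zrho; pose t := r / rho.
have t0 : 0 < t by rewrite divr_gt0.
have e0 : 0 < r / 8 by rewrite divr_gt0.
have [|w1 Zw1 [Gw1 n1]] := D (t *: z + y) (ZD _ _ (ZZ t Zz) Zy) _ _ e0.
  move=> i; rewrite !fctE addrK normrZ gtr0_norm //.
  have := zrho i; rewrite subr0 => h.
  by rewrite /t mulrAC ler_pdivrMr // ler_pM2l.
have [|w2 Zw2 [Gw2 n2]] := D y Zy _ _ e0.
  by move=> i; rewrite subrr normr0 ltW.
exists (t^-1 *: (w1 - w2)); split; first exact/ZZ/ZB.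
  have -> : (m%:R + m%:R) / r * rho = t^-1 * (m%:R + m%:R).
    by rewrite /t invf_div mulrC mulrA [rho / r * _]mulrAC.
  by apply: GZ; [rewrite invr_gt0|apply: GB].
move=> i; rewrite !fctE.
have -> : z i - t^-1 *: (w1 i - w2 i) = t^-1 *: (t *: z i + y i - w1 i - (y i - w2 i)).
  rewrite [t *: z i + _ - _]addrAC addrKA opprK -addrA [- _ + _]addrC [in RHS]scalerDr.
  by rewrite scalerA mulVf ?gt_eqF// scale1r -scalerN opprB.
rewrite normrZ gtr0_norm ?invr_gt0 // /t invf_div.
apply: (@le_trans _ _ (rho / r * (r / 8 + r / 8))).
  rewrite ler_pM2l ?divr_gt0 // (le_trans (ler_normB _ _)) // lerD //.
    by have := n1 i; rewrite !fctE.
by rewrite le_eqVlt; apply/orP; left; apply/eqP; field; rewrite gt_eqF.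
Qed.

(* [G C y] reads "the seminorm of y is at most C"; [G_sum] is its countable
   subadditivity, which replaces continuity.  A function space [I -> X] stands
   in for an abstract Banach space: [I] is [nat] for sequences and [unit] for
   [X] itself. *)
Lemma zabreiko
    (G_sum : forall B, 0 <= B -> exists C, forall (w : (I -> X)^nat) y,
       Z y -> (forall n, Z (w n)) -> (forall n, G (B * 4^-1 ^+ n) (w n)) ->
       (forall n i, `|y i - \sum_(k < n) w k i| <= 4^-1 ^+ n) -> G C y) :
  exists C, forall y, Z y -> (forall i, `|y i| <= 1) -> G C y.
Proof.
have [B B0 HB] := approx; have [C HC] := G_sum B B0; exists C => y Zy y1.
have /choice2 [next nextP] : forall n z, exists w, Z z -> near (4^-1 ^+ n) z 0 ->
    [/\ Z w, G (B * 4^-1 ^+ n) w & near (4^-1 * 4^-1 ^+ n) z w].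
  move=> n z; have [[Zz zn]|nz] := pselect (Z z /\ near (4^-1 ^+ n) z 0).
    by have [//|w Hw] := HB z (4^-1 ^+ n) Zz _ zn; exists w.
  by exists 0 => Zz zn; case: nz.
(* Successive approximation: [z n] is what remains of [y] after [n] corrections, and it has size at
   most [4^-1 ^+ n]. *)
pose fix z n := if n is n'.+1 then z n' - next n' (z n') else y.
have zP n : Z (z n) /\ near (4^-1 ^+ n) (z n) 0.
  elim: n => [|n [Zn nn]]; first by split => // i; rewrite subr0.
  have [Zw _ nw] := nextP n _ Zn nn; split; first exact: ZB.
  by move=> i; rewrite subr0 exprS; exact: nw.
have wP n := nextP n _ (zP n).1 (zP n).2.
apply: (HC (fun n => next n (z n))) => // [n|n|n i]; [by have [] := wP n|by have [] := wP n|].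
suff -> : y i - \sum_(k < n) next k (z k) i = z n i.
  by have := (zP n).2 i; rewrite subr0.
elim: n => [|n IH]; first by rewrite big_ord0 subr0.
by rewrite big_ord_recr /= opprD addrA IH.
Qed.

End zabreiko.
(** * Large sets of subsequences *)

Section ultrafilter_trees.
Variable U : set_system nat.
Hypotheses (U_ultra : UltraFilter U) (U_free : forall n, U [set i | (n <= i)%N]).

Definition branch (T : seq nat -> set nat) : set (nat -> nat) :=
  [set f | forall j, T (mkseq f j) (f j)].

Definition large (P : set (nat -> nat)) : Prop :=
  exists2 T, (forall s, U (T s)) & branch T `<=` P.

Lemma largeS P Q : P `<=` Q -> large P -> large Q.
Proof. by move=> PQ [T UT TP]; exists T => // f /TP /PQ. Qed.

Lemma largeI P Q : large P -> large Q -> large (P `&` Q).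
Proof.
move=> [T UT TP] [S US SQ]; exists (fun s => T s `&` S s).
  by move=> s; apply: filterI.
by move=> f TSf; split; [apply: TP|apply: SQ] => j; case: (TSf j).
Qed.

Lemma choose_next (S : seq nat -> set nat) : (forall s, U (S s)) ->
  exists f : nat -> nat, forall j, S (mkseq f j) (f j).
Proof.
move=> US; have [next Snext] := choice (fun s => filter_ex (US s)).
pose fix prefix k := if k is k'.+1 then
  rcons (prefix k') (next (prefix k')) else [::].
exists (next \o prefix) => j; suff -> : mkseq (next \o prefix) j = prefix j by exact: Snext.
by elim: j => //= j IH; rewrite mkseqS IH.
Qed.

(* A node of length at least n obeys the n-th tree after its first n entries
   are overwritten by those of a fixed branch of that tree. *)
Lemma large_diagonal (P : nat -> set (nat -> nat)) : (forall n, large (P n)) ->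
  large [set f | forall n, exists2 f', P n f' &
                   forall j, (n <= j)%N -> f' j = f j].
Proof.
move=> LP; have [T TP] := choice (fun n => (fun '(ex_intro2 T UT TP) =>
  ex_intro (fun T => (forall s, U (T s)) /\ branch T `<=` P n) T (conj UT TP)) (LP n)).
have [p pT] := choice (fun n => choose_next (TP n).1).
pose S n s := T n (mkseq (p n) n ++ drop n s).
(* Only the trees with index at most the length of the node constrain it, so this is a finite
   intersection. *)
exists (fun s i => forall n, (n <= size s)%N -> S n s i).
  move=> s; elim: (size s) => [|k IH].
    apply: filterS ((TP 0%N).1 (mkseq (p 0%N) 0 ++ drop 0 s)) => i Ti n.
    by rewrite leqn0 => /eqP ->.
  apply: filterS2 IH ((TP k.+1).1 (mkseq (p k.+1) k.+1 ++ drop k.+1 s)) => i Hi Ti n.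
  by rewrite leq_eqVlt => /orP [/eqP ->|/Hi].
move=> f fS n; exists (fun j => if (j < n)%N then p n j else f j); last first.
  by move=> j nj; rewrite ltnNge nj.
have [_] := TP n; apply=> j /=; case: ltnP => jn.
  have -> : mkseq (fun j => if (j < n)%N then p n j else f j) j = mkseq (p n) j.
    by apply/eq_in_map => i; rewrite mem_iota /= => /leq_trans /(_ (ltnW jn)) ->.
  exact: pT.
have := fS j n; rewrite size_mkseq => /(_ jn); rewrite /S.
congr (T n _ _); apply: (@eq_from_nth _ 0%N).
  by rewrite size_cat size_drop !size_mkseq subnKC.
move=> i; rewrite size_cat size_drop !size_mkseq subnKC// => ij.
rewrite nth_mkseq// nth_cat size_mkseq; case: ltnP => ni; first by rewrite nth_mkseq.
by rewrite nth_drop subnKC// nth_mkseq.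
Qed.

Lemma ultra_subseq (T : seq nat -> set nat) l : (forall s, U (T s)) ->
  U [set i | forall s, subseq s l -> T s i].
Proof.
elim: l T => [|x l IH] T UT.
  by apply: filterS (UT [::]) => i Ti s; rewrite subseq0 => /eqP ->.
have Ux := IH (fun s => T (x :: s)) (fun s => UT _).
apply: filterS (filterI (IH T UT) Ux) => i [Hi Hxi] [|y s] /=.
  by move=> _; apply: Hi; exact: sub0seq.
by case: eqP => [->|_]; [exact: Hxi|exact: Hi].
Qed.

(** Each [h j] is chosen admissible after every subsequence of the earlier values, finitely many
    conditions. Every [h \o g] is then itself a branch. *)
Lemma large_subsequences P : large P ->
  exists2 h : nat -> nat, increasing_seq h &
    forall g, increasing_seq g -> P (h \o g).
Proof.
move=> [T UT TP].
pose S l := [set i | forall s, subseq s l -> T s i] `&`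
            [set i | forall x, x \in l -> (x < i)%N].
have US l : U (S l).
  apply: filterI; first exact: ultra_subseq.
  (* The sum of the list serves as an upper bound for its entries. *)
  apply: filterS (U_free (\sum_(x <- l) x).+1) => i /= li x xl.
  by apply: leq_trans li; rewrite ltnS (big_rem x) //= leq_addr.
have [h hS] := choose_next US.
have hi : {homo h : m n / (m < n)%N >-> (m < n)%N}.
  move=> m n mn; have [_ /(_ (h m))] := hS n; apply.
  by apply/mapP; exists m => //; rewrite mem_iota.
have sub g j : {homo g : m n / (m < n)%N >-> (m < n)%N} ->
    subseq (mkseq (h \o g) j) (mkseq h (g j)).
  move=> gi; elim: j => [|j IH]; first exact: sub0seq.
  rewrite mkseqS; apply: (@subseq_trans _ (mkseq h (g j).+1)).
    rewrite mkseqS -!cats1; exact: cat_subseq.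
  have := gi j j.+1 (ltnSn j) => /subnKC <-; rewrite /mkseq iotaD map_cat.
  exact: prefix_subseq.
exists h.
  by apply/increasing_seqP => n; rewrite ltEnat/= hi.
move=> g gi; apply: TP => j /=; have [+ _] := hS (g j); apply; apply: sub.
by move=> m n mn; rewrite ltnNge -leEnat gi -ltnNge.
Qed.

(** * Determinacy of closed sets of branches *)

Section determinacy.
Variable E : seq nat -> Prop.

(* [refuted s] is a well-founded certificate that almost every extension of [s]
   eventually leaves [E]; quantifying over [A] keeps the definition positive. *)
Inductive refuted : seq nat -> Prop :=
| refuted_now s : ~ E s -> refuted s
| refuted_later s A : U A -> (forall i, A i -> refuted (rcons s i)) -> refuted s.

Lemma mkseq_rcons (f : nat -> nat) s :
  mkseq f (size s) = s -> mkseq f (size (rcons s (f (size s)))) = rcons s (f (size s)).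
Proof. by rewrite size_rcons mkseqS => ->. Qed.

(** Induction on the certificate glues the trees of the children of [s] into one tree above [s]. *)
Lemma refuted_tree s : refuted s ->
  exists2 T : seq nat -> set nat, (forall t, U (T t)) &
    forall f, mkseq f (size s) = s ->
      (forall j, (size s <= j)%N -> T (mkseq f j) (f j)) ->
      exists n, ~ E (mkseq f n).
Proof.
elim=> {s} [s nEs|s A UA _ IH].
  exists (fun=> setT) => [t|f fs _]; first exact: filterT.
  by exists (size s); rewrite fs.
have /choice [T HT] : forall i, exists T : seq nat -> set nat, (forall t, U (T t)) /\
    (A i -> forall f, mkseq f (size (rcons s i)) = rcons s i ->
      (forall j, (size (rcons s i) <= j)%N -> T (mkseq f j) (f j)) ->
      exists n, ~ E (mkseq f n)).
  move=> i; have [Ai|nAi] := pselect (A i); last first.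
    by exists (fun=> setT); split => // t; exact: filterT.
  by have [T UT HT] := IH i Ai; exists T.
(* The entry at position [size s] tells which child of [s] the node [t] lies above. *)
exists (fun t => if (size t <= size s)%N then A else T (nth 0%N t (size s)) t).
  by move=> t; case: ifP => // _; exact: (HT _).1.
move=> f fs fT; have Af := fT (size s) (leqnn _).
rewrite size_mkseq leqnn in Af.
apply: ((HT (f (size s))).2 Af f); first exact: mkseq_rcons.
move=> j; rewrite size_rcons => sj; have := fT j (ltnW sj).
by rewrite size_mkseq leqNgt sj /= nth_mkseq.
Qed.

(** If the root is not refuted, the ultrafilter property gives every unrefuted node a large set of
    unrefuted successors, and a branch through unrefuted nodes never leaves [E]. *)
Lemma large_determinacy :
  large [set f | forall n, E (mkseq f n)] \/
  large [set f | exists n, ~ E (mkseq f n)].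
Proof.
have [R0|nR0] := pselect (refuted [::]).
  right; have [T UT HT] := refuted_tree R0.
  by exists T => // f Tf; apply: HT.
left; pose T s := if pselect (refuted s) then setT else [set i | ~ refuted (rcons s i)].
exists T.
  move=> s; rewrite /T; case: pselect => nR; first exact: filterT.
  have [UR|//] := in_ultra_setVsetC [set i | refuted (rcons s i)] U_ultra.
  by exfalso; apply: nR; exact: refuted_later UR _.
move=> f Tf n; apply: contrapT => nE.
have: refuted (mkseq f n) by exact: refuted_now.
elim: n {nE} => // n IH; rewrite mkseqS => R.
by have := Tf n; rewrite /T; case: pselect => // nR; apply.
Qed.

End determinacy.
End ultrafilter_trees.
(** * Boundedness of the coordinates of a basic sequence *)

Section linear_combinations.
Variables (R : realType) (E : normedModType R).
Implicit Types (a b : R^nat) (u : E^nat).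

Lemma c00P a : c00 R a <-> exists n, forall i, (n <= i)%N -> a i = 0.
Proof.
split=> [/finite_seqP [s sa]|[n an]].
  exists (\sum_(x <- s) x).+1 => i si; apply: contrapT => ai.
  have : (a @^-1` [set~ 0]) i by [].
  rewrite sa /= => is_; suff : (i <= \sum_(x <- s) x)%N by rewrite leqNgt si.
  by rewrite (big_rem i) //= leq_addr.
apply: (@sub_finite_set _ _ `I_n); last exact: finite_II.
by move=> i /= ai; rewrite ltnNge; apply/negP => /an.
Qed.

Lemma lincombE a u n : (forall i, (n <= i)%N -> a i = 0) ->
  lincomb a u = \sum_(i < n) a i *: u i.
Proof.
move=> an; rewrite /lincomb (fsbig_ord _ n (fun i => a i *: u i)).
apply/esym/fsbig_widen => // i [_ /= /negP]; rewrite -leqNgt => /an.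
by move=> -> ; rewrite /= scale0r.
Qed.

Definition cut n a i := if (i < n)%N then a i else 0.

Lemma cut0 n a i : (n <= i)%N -> cut n a i = 0.
Proof. by rewrite /cut leqNgt => /negbTE ->. Qed.

Lemma sum_cut n m a u : (n <= m)%N ->
  \sum_(i < m) cut n a i *: u i = \sum_(i < n) a i *: u i.
Proof.
move=> nm; rewrite (big_ord_widen _ (fun i => a i *: u i) nm) [in RHS]big_mkcond /=.
by apply: eq_bigr => i _; rewrite /cut; case: ifP; rewrite ?scale0r.
Qed.

Lemma lincomb_cut n a u : lincomb (cut n a) u = \sum_(i < n) a i *: u i.
Proof. by rewrite (lincombE _ (@cut0 n a)) sum_cut. Qed.

Lemma c00_cut n a : c00 R (cut n a).
Proof. by apply/c00P; exists n => i; exact: cut0. Qed.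

Lemma closed_spanP u y : closed_span u y <->
  forall e : R, 0 < e -> exists n a, `|y - \sum_(i < n) a i *: u i| <= e.
Proof.
split=> [yc e e0|H].
  have [|_ [[a /c00P [n an] <-]]] := yc (ball y e); first exact: nbhsx_ballx.
  by rewrite -ball_normE /= (lincombE _ an) => /ltW; exists n, a.
move=> B /nbhs_ballP [e /= e0 yB].
have [n [a na]] := H (e / 2) (divr_gt0 e0 (ltr0Sn _ 1)).
exists (\sum_(i < n) a i *: u i); split.
  by exists (cut n a); [exact: c00_cut|exact: lincomb_cut].
apply: yB; rewrite -ball_normE /=; apply: le_lt_trans na _.
by rewrite ltr_pdivrMr // ltr_pMr // ltr1n.
Qed.

Lemma closed_span_sum u n a : closed_span u (\sum_(i < n) a i *: u i).
Proof. by apply/closed_spanP => e /ltW e0; exists n, a; rewrite subrr normr0. Qed.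

Lemma closed_spanB u y z :
  closed_span u y -> closed_span u z -> closed_span u (y - z).
Proof.
move=> /closed_spanP Hy /closed_spanP Hz; apply/closed_spanP => e e0.
have e2 : 0 < e / 2 by rewrite divr_gt0.
have [n [a na]] := Hy _ e2; have [m [b mb]] := Hz _ e2.
exists (maxn n m), (fun i => cut n a i - cut m b i).
have -> : \sum_(i < maxn n m) (cut n a i - cut m b i) *: u i =
    \sum_(i < n) a i *: u i - \sum_(i < m) b i *: u i.
  rewrite -(@sum_cut n (maxn n m)) ?leq_maxl // -(@sum_cut m (maxn n m)) ?leq_maxr //.
  by rewrite -sumrB; apply: eq_bigr => i _; rewrite scalerBl.
have -> (s t : E) : y - z - (s - t) = (y - s) - (z - t).
  by rewrite !opprB [t - s]addrC addrACA [- z + t]addrC.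
by rewrite (le_trans (ler_normB _ _)) // [leRHS]splitr lerD.
Qed.

Lemma closed_spanZ u (t : R) y : closed_span u y -> closed_span u (t *: y).
Proof.
move=> /closed_spanP Hy; apply/closed_spanP => e e0.
have t0 : 0 < `|t| + 1 by rewrite ltr_wpDl.
have [n [a na]] := Hy _ (divr_gt0 e0 t0).
exists n, (fun i => t * a i).
have -> : \sum_(i < n) (t * a i) *: u i = t *: (\sum_(i < n) a i *: u i).
  by rewrite scaler_sumr; apply: eq_bigr => i _; rewrite scalerA.
rewrite -scalerBr normrZ; apply: le_trans (ler_wpM2l (normr_ge0 t) na) _.
by rewrite mulrCA ler_piMr ?(ltW e0) // ler_pdivrMr // mul1r lerDl.
Qed.

Lemma closed_span_lim u (y_ : E^nat) (r : R^nat) y : r @ \oo --> (0 : R) ->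
  (forall n, closed_span u (y_ n)) -> (forall n, `|y - y_ n| <= r n) ->
  closed_span u y.
Proof.
move=> /cvgrPdist_le r0 Hy yr; apply/closed_spanP => e e0.
have e2 : 0 < e / 2 by rewrite divr_gt0.
have [N _ /(_ N (leqnn N)) /=] := r0 _ e2; rewrite sub0r normrN => rN.
have /closed_spanP /(_ _ e2) [n [a na]] := Hy N; exists n, a.
rewrite -(subrKA (y_ N)) (le_trans (ler_normD _ _)) // [leRHS]splitr lerD //.
by apply: le_trans (yr N) (le_trans (ler_norm _) rN).
Qed.

End linear_combinations.
Arguments closed_span_sum {R E} u n a.

Lemma sum_geometric (R : realFieldType) n m : (n <= m)%N ->
  \sum_(n <= k < m) 4^-1 ^+ k <= 2 * 4^-1 ^+ n :> R.
Proof.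
(* The subtracted term makes the bound strong enough for induction on [m]. *)
move=> nm; apply: (@le_trans _ _ (2 * (4^-1 ^+ n - 4^-1 ^+ m))); last first.
  by rewrite ler_pM2l // gerBl exprn_ge0 // invr_ge0.
elim: m nm => [|m IH]; first by rewrite leqn0 => /eqP ->; rewrite big_geq // subrr mulr0.
rewrite leq_eqVlt => /orP [/eqP ->|]; first by rewrite big_geq // subrr mulr0.
rewrite ltnS => nm; rewrite big_nat_recr //= exprS.
have h := IH nm; have m0 : 0 <= 4^-1 ^+ m :> R by rewrite exprn_ge0 // invr_ge0.
by lra.
Qed.

Lemma cvg_geometric0 (R : realType) (c : R) : (fun n => c * 4^-1 ^+ n) @ \oo --> (0 : R).
Proof.
rewrite -[0](mulr0 c); apply: cvgMr; apply: cvg_expr.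
by rewrite ger0_norm ?invr_ge0// invf_lt1// ltr1n.
Qed.

Section basis_constant.
Variables (R : realType) (W : completeNormedModType R) (v : W^nat).
Hypotheses (v_basic : basic_sequence v) (v_normalized : normalized v).

Let psum (a : R^nat) n := \sum_(i < n) a i *: v i.

(** The seminorm here is the supremum of the norms of the partial sums of the expansion. *)
Let bounded_expansion C (y : unit -> W) := exists a : R^nat,
  psum a @ \oo --> y tt /\ forall n, `|psum a n| <= C.

Let series_psum a : series (fun n => a n *: v n) = psum a.
Proof. by apply/funext => n; rewrite /series /= big_mkord. Qed.

Let coord_bound a C i : (forall n, `|psum a n| <= C) -> `|a i| <= C + C.
Proof.
move=> aC; have -> : `|a i| = `|psum a i.+1 - psum a i|.
  by rewrite /psum big_ord_recr /= addrAC subrr add0r normrZ v_normalized mulr1.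
by rewrite (le_trans (ler_normB _ _)) // lerD.
Qed.

(** Expansions are added coordinatewise: the coordinate sums [A m j] converge to [b j], and the
    limits in [m] and [n] may be exchanged because the tails are small uniformly in [n]. *)
Let expansion_sum B : 0 <= B -> exists C, forall (w : (unit -> W)^nat) y,
  closed_span v (y tt) -> (forall n, closed_span v (w n tt)) ->
  (forall n, bounded_expansion (B * 4^-1 ^+ n) (w n)) ->
  (forall n i, `|y i - \sum_(k < n) w k i| <= 4^-1 ^+ n) -> bounded_expansion C y.
Proof.
move=> B0; exists (2 * B) => w y _ _ /choice [a aP] yw.
pose A m j := \sum_(k < m) a k j.
pose T m n := \sum_(k < m) psum (a k) n.
have tail (V : normedModType R) (x : V^nat) D m M : 0 <= D -> (m <= M)%N ->
    (forall k, `|x k| <= D * 4^-1 ^+ k) ->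
    `|\sum_(k < M) x k - \sum_(k < m) x k| <= 2 * D * 4^-1 ^+ m.
  move=> D0 mM xD; rewrite -!(big_mkord xpredT x) (big_cat_nat (leq0n m) mM) /=.
  rewrite addrAC subrr add0r (le_trans (ler_norm_sum _ _ _)) //.
  apply: (@le_trans _ _ (\sum_(m <= k < M) D * 4^-1 ^+ k)); first exact: ler_sum.
  by rewrite -mulr_sumr -mulrA mulrCA ler_wpM2l // sum_geometric.
have /choice [b bP] : forall j, exists l : R^o, forall m,
    `|l - A m j| <= 2 * (B + B) * 4^-1 ^+ m.
  move=> j; apply: (@cauchy_limit R R^o (A ^~ j)); first exact: cvg_geometric0.
  move=> n m nm; apply: (tail R^o (a^~ j) _ n m (addr_ge0 B0 B0) nm) => k.
  by rewrite mulrDl; apply: coord_bound; exact: (aP k).2.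
(* For fixed [n], the [n] coordinate errors vanish far out in the sum over [k]; what remains is a
   geometric tail whose bound does not involve [n]. *)
have TP m n : `|psum b n - T m n| <= 2 * B * 4^-1 ^+ m.
  apply/ler_addgt0Pr => e e0.
  have /cvgrPdist_le /(_ e e0) [N _ HN] := @cvg_geometric0 R (n%:R * (2 * (B + B))).
  have := HN (maxn N m) (leq_maxl _ _); rewrite /= sub0r normrN => He.
  rewrite -(subrKA (T (maxn N m) n)) (le_trans (ler_normD _ _)) // addrC lerD //.
    apply: (tail W (fun k => psum (a k) n) _ m _ B0 (leq_maxr _ _)) => k.
    exact: (aP k).2.
  apply: le_trans (le_trans (ler_norm _) He).
  have -> : T (maxn N m) n = \sum_(i < n) A (maxn N m) i *: v i.
    rewrite /T /psum exchange_big /=; apply: eq_bigr => i _.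
    by rewrite scaler_suml.
  rewrite -sumrB (le_trans (ler_norm_sum _ _ _)) //.
  apply: (@le_trans _ _ (\sum_(i < n) 2 * (B + B) * 4^-1 ^+ (maxn N m))).
    apply: ler_sum => i _; rewrite -scalerBl normrZ v_normalized mulr1; exact: bP.
  by rewrite sumr_const card_ord -[leRHS]mulrA [leRHS]mulr_natl lexx.
exists b; split; last first.
  (* The case [m = 0], where [T] vanishes, is the bound on the partial sums. *)
  move=> n; have := TP 0%N n; rewrite /T big_ord0 subr0 expr0 mulr1; exact.
apply/cvgrPdist_le => e e0; have e2 : 0 < e / 2 by rewrite divr_gt0.
have /cvgrPdist_le /(_ _ e2) [m _ /(_ m (leqnn m))] := @cvg_geometric0 R (2 * B + 1).
rewrite /= sub0r normrN => /(le_trans (ler_norm _)) Hm.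
have Tc : T m @ \oo --> \sum_(k < m) w k tt.
  by apply: cvg_big => [|k _]; [exact: add_continuous|exact: (aP k).1].
have /cvgrPdist_le /(_ _ e2) := Tc; apply: filterS => n Hn.
have -> : y tt - psum b n = (y tt - \sum_(k < m) w k tt) +
    (\sum_(k < m) w k tt - T m n) - (psum b n - T m n).
  by rewrite subrKA opprB subrKA.
apply: (le_trans (ler_normB _ _)); apply: (le_trans (lerD (ler_normD _ _) (lexx _))).
have := yw m tt; have := TP m n; move: Hn Hm => /=; lra.
Qed.

(** Zabreiko's lemma bounds all partial sums on the unit ball of the span by [C]. By uniqueness a
    finite sum is its own expansion, and a coordinate is a difference of two partial sums, whence
    [K = C + C]. *)
Lemma basis_constant : exists2 K : R, 0 <= K & forall n (a : R^nat),
  `|\sum_(i < n) a i *: v i| <= 1 -> forall i, (i < n)%N -> `|a i| <= K.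
Proof.
have [||||||||C HC] := @zabreiko R W unit [set y | closed_span v (y tt)]
  bounded_expansion _ _ _ _ _ _ _ _ expansion_sum.
- by have := closed_span_sum v 0 (fun=> 0); rewrite big_ord0.
- by move=> y z; exact: closed_spanB.
- by move=> t y; exact: closed_spanZ.
- by move=> u r y r0 uZ yu; apply: (closed_span_lim r0 uZ) => n; exact: yu.
- by move=> C C' y CC' [a [ay aC]]; exists a; split => // n; exact: le_trans (aC n) CC'.
- move=> C C' y z [a [ay aC]] [b [bz bC]]; exists (a - b).
  have -> : psum (a - b) = psum a - psum b.
    by apply/funext => n; rewrite !fctE -sumrB; apply: eq_bigr => i _; rewrite /= scalerBl.
  split; first exact: cvgB.
  by move=> n; rewrite !fctE (le_trans (ler_normB _ _)) // lerD.
- move=> C t y t0 [a [ay aC]]; exists (t *: a).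
  have -> : psum (t *: a) = t *: psum a.
    by apply/funext => n; rewrite !fctE scaler_sumr; apply: eq_bigr => i _; rewrite /= scalerA.
  split; first by apply: cvgZr.
  by move=> n; rewrite !fctE normrZ gtr0_norm // ler_pM2l.
- move=> y Zy; have [a [+ _]] := v_basic.2 _ Zy; rewrite series_psum => ay.
  have /cvg_seq_bounded [M [Mr HM]] : cvg (psum a @ \oo) by apply/cvg_ex; exists (y tt).
  by exists (M + 1), a; split => // n; apply: HM => //; rewrite ltrDl.
have C0 : 0 <= C.
  have [|i|a [_ /(_ 0%N)]] := HC (fun=> 0); last exact: le_trans.
    by have := closed_span_sum v 0 (fun=> 0); rewrite big_ord0.
  by rewrite normr0.
exists (C + C); first exact: addr_ge0.
move=> n a a1 i ni.
have Zy := closed_span_sum v n a.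
have [_|b [by_ bC]] := HC (fun=> \sum_(i < n) a i *: v i) Zy; first by [].
have [c [_ cU]] := v_basic.2 _ Zy.
have cb : c = b by apply: cU; rewrite series_psum.
have ca : c = cut n a.
  apply: cU; rewrite series_psum; apply: cvg_near_cst; exists n => // m /= nm.
  exact: sum_cut.
have -> : a i = b i by rewrite -cb ca /cut ni.
exact: coord_bound.
Qed.

End basis_constant.
(** * Upper estimates *)

Lemma sum_geometric_mul (R : realFieldType) m :
  \sum_(k < m) k%:R * 4^-1 ^+ k <= 1 :> R.
Proof.
(* Again a sharper bound that passes through the induction. *)
apply: (@le_trans _ _ (1 - (2 * m%:R + 1) * 4^-1 ^+ m)); last first.
  by rewrite gerBl mulr_ge0 // ?exprn_ge0 ?invr_ge0 // addr_ge0 // mulr_ge0.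
elim: m => [|m IH]; first by rewrite big_ord0 expr0 mulr0 add0r mulr1 subrr.
rewrite big_ord_recr /= exprS -[m.+1%:R]natr1.
have m0 : 0 <= m%:R :> R by []; have q0 : 0 <= 4^-1 ^+ m :> R by rewrite exprn_ge0 // invr_ge0.
have mq : 0 <= m%:R * 4^-1 ^+ m :> R by rewrite mulr_ge0.
set q := 4^-1 ^+ m in IH q0 mq *.
have -> : (2 * (m%:R + 1) + 1) * (4^-1 * q) = (2 * (m%:R * q) + 3 * q) / 4 :> R by field.
have : (2 * m%:R + 1) * q = 2 * (m%:R * q) + q by ring.
by move: IH; lra.
Qed.

Lemma increasing_ge_id (f : nat -> nat) : increasing_seq f -> forall i, (i <= f i)%N.
Proof.
move=> fi; elim=> // i; move/leq_ltn_trans; apply.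
by rewrite ltnNge -leEnat fi -ltnNge.
Qed.

Section upper_estimates.
Variables (R : realType) (W X : normedModType R) (v : W^nat).
Implicit Types (y z : X^nat) (C : R).

Lemma upper_estimateP C y : upper_estimate v C y <->
  forall n (a : R^nat), `|\sum_(i < n) a i *: v i| <= 1 ->
    `|\sum_(i < n) a i *: y i| <= C.
Proof.
split=> [yC n a|yC a /c00P [n an]].
  by rewrite -!lincomb_cut => /(yC _ (@c00_cut _ n a)).
by rewrite !(lincombE _ an) => /yC.
Qed.

Lemma upper_estimateS C C' y : C <= C' -> upper_estimate v C y -> upper_estimate v C' y.
Proof. by move=> CC' yC a /yC /[apply] /le_trans; apply. Qed.

Lemma upper_estimateB C C' y z : upper_estimate v C y -> upper_estimate v C' z ->
  upper_estimate v (C + C') (y - z).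
Proof.
move=> /upper_estimateP yC /upper_estimateP zC; apply/upper_estimateP => n a a1.
have -> : \sum_(i < n) a i *: (y - z) i =
    \sum_(i < n) a i *: y i - \sum_(i < n) a i *: z i.
  by rewrite -sumrB; apply: eq_bigr => i _; rewrite -scalerBr.
by rewrite (le_trans (ler_normB _ _)) // lerD //; [exact: yC|exact: zC].
Qed.

Lemma upper_estimateZ C (t : R) y : 0 < t -> upper_estimate v C y ->
  upper_estimate v (t * C) (t *: y).
Proof.
move=> t0 /upper_estimateP yC; apply/upper_estimateP => n a a1.
have -> : \sum_(i < n) a i *: (t *: y) i = t *: \sum_(i < n) a i *: y i.
  by rewrite scaler_sumr; apply: eq_bigr => i _; rewrite !scalerA mulrC.
by rewrite normrZ gtr0_norm // ler_pM2l // yC.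
Qed.

Variable K : R.
Hypothesis K0 : 0 <= K.
Hypothesis K_coord : forall n (a : R^nat),
  `|\sum_(i < n) a i *: v i| <= 1 -> forall i, (i < n)%N -> `|a i| <= K.

Lemma norm_lincomb_le n (a : R^nat) y (d : R^nat) :
  `|\sum_(i < n) a i *: v i| <= 1 -> (forall i, `|y i| <= d i) ->
  `|\sum_(i < n) a i *: y i| <= K * \sum_(i < n) d i.
Proof.
move=> a1 yd; rewrite (le_trans (ler_norm_sum _ _ _)) // mulr_sumr ler_sum // => i _.
by rewrite normrZ ler_pM //; exact: K_coord a1 _ (ltn_ord i).
Qed.

Lemma upper_estimate_perturb C D y z (d : R^nat) :
  (forall i, `|z i - y i| <= d i) -> (forall n, \sum_(i < n) d i <= D) ->
  upper_estimate v C y -> upper_estimate v (C + K * D) z.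
Proof.
move=> yzd dD /upper_estimateP yC; apply/upper_estimateP => n a a1.
have -> : \sum_(i < n) a i *: z i =
    \sum_(i < n) a i *: y i + \sum_(i < n) a i *: (z i - y i).
  by rewrite -big_split /=; apply: eq_bigr => i _; rewrite -scalerDr subrKC.
rewrite (le_trans (ler_normD _ _)) // lerD //; first exact: yC.
apply: le_trans (norm_lincomb_le a1 yzd) _.
by rewrite ler_wpM2l.
Qed.

(** The price of the initial terms overwritten in a diagonalisation: [n] terms move by at most
    [c + c], with coefficients at most [K]. *)
Lemma upper_estimate_prefix C c n y (f g : nat -> nat) : 0 <= c ->
  (forall i, `|y i| <= c) -> (forall j, (n <= j)%N -> f j = g j) ->
  upper_estimate v C (y \o f) ->
  upper_estimate v (C + K * (n%:R * (c + c))) (y \o g).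
Proof.
move=> c0 yc fg; apply: (@upper_estimate_perturb _ _ _ _ (cut n (fun=> c + c))) => [i|m].
  rewrite /cut /=; case: ltnP => [_|/fg ->]; last by rewrite subrr normr0.
  by rewrite (le_trans (ler_normB _ _)) // lerD.
have cut_ge0 i : 0 <= cut n (fun=> c + c) i by rewrite /cut; case: ifP; rewrite ?addr_ge0.
apply: (@le_trans _ _ (\sum_(i < m + n) cut n (fun=> c + c) i)).
  by rewrite big_split_ord /= lerDl sumr_ge0.
rewrite addnC big_split_ord /= [X in _ + X]big1 ?addr0; last first.
  by move=> i _; rewrite cut0 // leq_addr.
have -> : n%:R * (c + c) = \sum_(i < n) (c + c) by rewrite sumr_const card_ord mulr_natl.
by apply: ler_sum => i _; rewrite /cut ltn_ord.
Qed.

End upper_estimates.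

(** * Stability of weakly null sequences *)

Section weakly_null_sequences.
Variables (R : realType) (X : normedModType R).
Implicit Types (y z : X^nat) (f : {linear X -> R^o}).

Lemma functional_bound f : continuous f ->
  exists2 M : R, 0 < M & forall x, `|f x| <= M * `|x|.
Proof.
move=> /linear_bounded_continuous /linear_boundedP /pinfty_ex_gt0 [M M0 fM].
by exists M.
Qed.

Lemma weakly_null0 : weakly_null (0 : X^nat).
Proof. by move=> f _; apply: cvg_near_cst; apply: nearW => n /=; rewrite linear0. Qed.

Lemma weakly_nullB y z : weakly_null y -> weakly_null z -> weakly_null (y - z).
Proof.
move=> y0 z0 f fc; have -> : f \o (y - z) = (fun n => f (y n) - f (z n)).
  by apply/funext => n /=; rewrite !fctE linearB.
by rewrite -[0]subr0; apply: cvgB; [exact: y0|exact: z0].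
Qed.

Lemma weakly_null_bounded_mul (t : R^nat) M y : (forall n, `|t n| <= M) ->
  weakly_null y -> weakly_null (fun n => t n *: y n).
Proof.
move=> tM y0 f fc; have M0 : 0 <= M by apply: le_trans (tM 0%N).
apply/cvgr0Pnorm_le => e e0; have e1 : 0 < e / (M + 1) by rewrite divr_gt0 // ltr_wpDl.
have /cvgr0Pnorm_le /(_ _ e1) := y0 f fc; apply: filterS => n /= yn.
rewrite linearZ /= normrM; apply: le_trans (ler_pM _ _ (tM n) yn) _ => //.
by rewrite mulrCA ler_piMr ?(ltW e0) // ler_pdivrMr ?mul1r ?lerDl // ltr_wpDl.
Qed.

Lemma weakly_nullZ (t : R) y : weakly_null y -> weakly_null (t *: y).
Proof. exact: (@weakly_null_bounded_mul (fun=> t) `|t|). Qed.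

Lemma weakly_null_subseq y (g : nat -> nat) : increasing_seq g ->
  weakly_null y -> weakly_null (y \o g).
Proof.
move=> gi y0 f fc; apply: (@cvg_comp _ _ _ g (f \o y) _ \oo); last exact: y0.
move=> P [N _ NP]; exists N => // n /= Nn; apply: NP => /=.
exact: leq_trans Nn (increasing_ge_id gi n).
Qed.

Lemma weakly_null_lim (u : (X^nat)^nat) (r : R^nat) y : r @ \oo --> (0 : R) ->
  (forall n, weakly_null (u n)) -> (forall n i, `|y i - u n i| <= r n) ->
  weakly_null y.
Proof.
move=> /cvgr0Pnorm_le r0 u0 yu f fc; have [M M0 fM] := functional_bound fc.
apply/cvgr0Pnorm_le => e e0; have e2 : 0 < e / 2 by rewrite divr_gt0.
have [N _ /(_ N (leqnn N)) /= rN] := r0 _ (divr_gt0 e2 M0).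
have /cvgr0Pnorm_le /(_ _ e2) := u0 N f fc; apply: filterS => n /= un.
rewrite -[f (y n)](subrK (f (u N n))) (le_trans (ler_normD _ _)) // [leRHS]splitr lerD //.
rewrite -linearB (le_trans (fM _)) // -ler_pdivlMl // mulrC.
exact: le_trans (yu N n) (le_trans (ler_norm _) rN).
Qed.

End weakly_null_sequences.

(** * From individual constants to a uniform one *)

Section uniformity.
Variables (R : realType) (W X : completeNormedModType R) (v : W^nat) (K : R).
Hypothesis K0 : 0 <= K.
Hypothesis K_coord : forall n (a : R^nat),
  `|\sum_(i < n) a i *: v i| <= 1 -> forall i, (i < n)%N -> `|a i| <= K.
Variable U : set_system nat.
Hypotheses (U_ultra : UltraFilter U) (U_free : forall n, U [set i | (n <= i)%N]).

Definition large_estimate C (y : X^nat) :=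
  large U [set f : nat -> nat | upper_estimate v C (y \o f)].

(** An upper estimate is a closed condition: it fails as soon as it fails on an initial segment of
    the subsequence. *)
Lemma large_estimate_determinacy C (y : X^nat) : ~ large_estimate C y ->
  large U [set f : nat -> nat | ~ upper_estimate v C (y \o f)].
Proof.
pose E s := forall a : R^nat, `|\sum_(i < size s) a i *: v i| <= 1 ->
  `|\sum_(i < size s) a i *: y (nth 0%N s i)| <= C.
have EP f n : E (mkseq f n) <-> forall a : R^nat,
    `|\sum_(i < n) a i *: v i| <= 1 -> `|\sum_(i < n) a i *: y (f i)| <= C.
  rewrite /E size_mkseq.
  have e a : \sum_(i < n) a i *: y (nth 0%N (mkseq f n) i) = \sum_(i < n) a i *: y (f i).
    by apply: eq_bigr => i _; rewrite nth_mkseq.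
  by split=> H a /H; rewrite e.
move=> nL; have [L|] := large_determinacy U_ultra E; last first.
  apply: largeS => f /= [n nE] /upper_estimateP yf; apply: nE.
  by apply/EP => a; exact: yf.
exfalso; apply: nL; apply: largeS L => f Ef; apply/upper_estimateP => n a.
by have /EP := Ef n; apply.
Qed.

(* [property_S] only speaks of normalized sequences: first extract a
   subsequence whose norms converge summably fast, so that dividing by the
   norms is a summable perturbation of dividing by their limit. *)
Lemma property_S_bounded (y : X^nat) c : property_S X v -> weakly_null y ->
  (forall i, `|y i| <= c) ->
  exists2 g, increasing_seq g & exists C, upper_estimate v C (y \o g).
Proof.
move=> S y0 yc.
have [|h hi /cvg_ex [l hl]] := @bolzano_weierstrass R (fun i => `|y i|).
  exists c; split=> [|M cM i _ /=]; first exact: num_real.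
  by rewrite normr_id (le_trans (yc i)) // ltW.
(* Fast convergence comes from a tree whose condition at a node depends only on the node's
   length. *)
have extract e : 0 < e -> exists2 g, increasing_seq g &
    forall i, `| `|y (g i)| - l| <= e * 4^-1 ^+ i.
  move=> e0; have /large_subsequences : large U [set f : nat -> nat | forall j,
      `| `|y (h (f j))| - l| <= e * 4^-1 ^+ j].
    exists (fun s => [set i | `| `|y (h i)| - l| <= e * 4^-1 ^+ size s]).
      move=> s; have q0 : 0 < e * 4^-1 ^+ size s by rewrite mulr_gt0 // exprn_gt0 // invr_gt0.
      have /cvgrPdist_le /(_ _ q0) [N _ HN] := hl.
      by apply: filterS (U_free N) => i /HN; rewrite distrC.
    by move=> f fT j; have := fT j; rewrite /= size_mkseq.
  move=> /(_ U_free) [g gi gP]; exists (h \o g).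
    by move=> m n; rewrite /= hi -leEnat gi.
  by move=> i; apply: (gP id).
(* If the norms tend to 0, the subsequence is a summable perturbation of the zero sequence. *)
have [l0|l0] := leP l 0.
  have [g gi gl] := extract 1 ltr01; exists g => //.
  exists (0 + K * 2).
  apply: (@upper_estimate_perturb _ _ _ _ _ K0 K_coord _ _ 0 _ (fun i => 4^-1 ^+ i)).
  - move=> i /=; rewrite subr0; have := gl i; rewrite mul1r; apply: le_trans.
    by apply: le_trans (ler_norm _); rewrite lerBrDr gerDl.
  - by move=> n; rewrite -(big_mkord xpredT) (le_trans (sum_geometric _ _)) // expr0 mulr1.
  apply/upper_estimateP => n a _; rewrite big1 ?normr0 // => i _; exact: scaler0.
have l2 : 0 < l / 2 by rewrite divr_gt0.
(* The tolerance [l / 2] keeps all norms above [l / 2], so their reciprocals are bounded and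
   normalizing preserves weak nullity. *)
have [g gi gl] := extract (l / 2) l2.
pose t i := `|y (g i)|^-1.
have yl i : l / 2 <= `|y (g i)|.
  have : `| `|y (g i)| - l| <= l / 2.
    rewrite (le_trans (gl i)) // ler_piMr ?(ltW l2) //.
    by rewrite exprn_ile1 ?invr_ge0 // invf_le1 // ler1n.
  by rewrite ler_norml => /andP [+ _]; lra.
have yg0 i : 0 < `|y (g i)| := lt_le_trans l2 (yl i).
have [||g' [g'i [C Cest]]] := S (fun i => t i *: y (g i)).
- by move=> i; rewrite normrZ ger0_norm ?invr_ge0 // mulVf // gt_eqF.
- apply: (@weakly_null_bounded_mul _ _ t (l / 2)^-1); last exact: weakly_null_subseq.
  by move=> i; rewrite ger0_norm ?invr_ge0 // lef_pV2 ?posrE // yl.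
exists (g \o g'); first by move=> m n; rewrite /= gi -leEnat g'i.
have := upper_estimateZ l0 Cest => Cl.
exists (l * C + K * (l / 2 * 2)).
apply: (@upper_estimate_perturb _ _ _ _ _ K0 K_coord _ _ _ _
  (fun i => l / 2 * 4^-1 ^+ i) _ _ Cl).
  move=> i; rewrite !fctE /t -[y (g (g' i)) in X in X - _]scale1r scalerA -scalerBl normrZ.
  rewrite -[X in _ * X]gtr0_norm // -normrM mulrBl mul1r divfK ?gt_eqF //.
  apply: le_trans (gl _) _; rewrite ler_pM2l //.
  by apply: ler_wiXn2l; rewrite ?invr_ge0 ?invf_le1 ?ler1n // increasing_ge_id.
move=> n; rewrite -mulr_sumr ler_pM2l // -(big_mkord xpredT).
by rewrite (le_trans (sum_geometric _ _)) // expr0 mulr1.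
Qed.

(** Otherwise determinacy makes failure of every bound large. Diagonalising yields a subsequence of
    [y] none of whose subsequences has an upper estimate, against [property_S_bounded]. *)
Lemma large_estimate_finite (y : X^nat) c : property_S X v -> weakly_null y ->
  (forall i, `|y i| <= c) -> exists C, large_estimate C y.
Proof.
move=> S y0 yc; apply: contrapT => /forallNP nL.
have c0 : 0 <= c by apply: le_trans (yc 0%N).
(* The second summand pays for the [n] terms that the diagonalisation overwrites. *)
pose D n : R := n%:R + K * (n%:R * (c + c)).
have := large_diagonal U_ultra (fun n => large_estimate_determinacy (nL (D n))).
move=> /(large_subsequences U_ultra U_free) [h hi hP].
have [||g gi [C yC]] := @property_S_bounded (y \o h) c S; first exact: weakly_null_subseq.
  by move=> i; exact: yc.
pose n := Num.bound C; have [f nf fh] := hP g gi n; apply: nf.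
have CD : C + K * (n%:R * (c + c)) <= D n.
  by rewrite lerD2r ltW // unstable.ltr_bound.
apply: upper_estimateS CD _.
by apply: (upper_estimate_prefix K0 K_coord (f := h \o g) c0 yc) => // j nj; rewrite fh.
Qed.

(** A diagonal branch agrees from index [k] on with one that is good for [w k]. Overwriting [k]
    terms of size [2 * 4^-1 ^+ k] costs [4 * K * (k%:R * 4^-1 ^+ k)], which is summable. *)
Lemma large_estimate_sum B : 0 <= B -> exists C, forall (w : (X^nat)^nat) (y : X^nat),
  (forall n, large_estimate (B * 4^-1 ^+ n) (w n)) ->
  (forall n i, `|y i - \sum_(k < n) w k i| <= 4^-1 ^+ n) -> large_estimate C y.
Proof.
move=> B0; exists (2 * B + 4 * K) => w y wB yw.
(* Each [w n] is the difference of two consecutive errors. *)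
have w_small n i : `|w n i| <= 2 * 4^-1 ^+ n.
  have -> : w n i = (y i - \sum_(k < n) w k i) - (y i - \sum_(k < n.+1) w k i).
    by rewrite big_ord_recr /= opprB -[_ + w n i - _]addrA subrKA subrKC.
  rewrite (le_trans (ler_normB _ _)) //; have := yw n i; have := yw n.+1 i.
  rewrite exprS; have q0 : 0 <= 4^-1 ^+ n :> R by rewrite exprn_ge0 // invr_ge0.
  lra.
apply: largeS (large_diagonal U_ultra wB) => f fP; apply/upper_estimateP => n a a1.
have wf k : `|\sum_(i < n) a i *: w k (f i)| <=
    B * 4^-1 ^+ k + 4 * K * (k%:R * 4^-1 ^+ k).
  have [f' wf' f'f] := fP k.
  have q0 : 0 <= 2 * 4^-1 ^+ k :> R by rewrite mulr_ge0 // exprn_ge0 // invr_ge0.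
  have /upper_estimateP /(_ n a a1) /le_trans :=
    upper_estimate_prefix K0 K_coord q0 (w_small k) f'f wf'.
  apply; rewrite lerD2l le_eqVlt; apply/orP; left; apply/eqP; ring.
apply/ler_addgt0Pr => e e0.
(* With [n] fixed, the remainder after [m] summands contributes at most [K * n%:R * 4^-1 ^+ m]. *)
have /cvgr0Pnorm_le /(_ e e0) [m _ /(_ m (leqnn m)) /=] := @cvg_geometric0 R (K * n%:R).
move=> /(le_trans (ler_norm _)) He.
have -> : \sum_(i < n) a i *: y (f i) = \sum_(k < m) \sum_(i < n) a i *: w k (f i) +
    \sum_(i < n) a i *: (y (f i) - \sum_(k < m) w k (f i)).
  rewrite exchange_big -big_split /=; apply: eq_bigr => i _.
  by rewrite -scaler_sumr -scalerDr subrKC.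
rewrite (le_trans (ler_normD _ _)) // lerD //.
  rewrite (le_trans (ler_norm_sum _ _ _)) //; apply: (@le_trans _ _ (\sum_(k < m)
    (B * 4^-1 ^+ k + 4 * K * (k%:R * 4^-1 ^+ k)))); first by apply: ler_sum => k _; exact: wf.
  rewrite big_split /= -!mulr_sumr lerD //.
    rewrite mulrC ler_wpM2r // -(big_mkord xpredT).
    by rewrite (le_trans (sum_geometric _ _)) // expr0 mulr1.
  by rewrite ler_piMr ?mulr_ge0 // sum_geometric_mul.
apply: le_trans He.
have /le_trans -> // := norm_lincomb_le K_coord
  (y := fun i => y (f i) - \sum_(k < m) w k (f i)) a1 (fun i => yw m (f i)).
by rewrite sumr_const card_ord -mulrA mulr_natl.
Qed.

Lemma property_S_U : property_S X v -> property_U X v.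
Proof.
move=> S.
pose Z : set (nat -> X) := [set y | weakly_null y /\ exists c, forall i, `|y i| <= c].
have [||||||||B B0|C HC] := @zabreiko R X nat Z large_estimate.
- by split; [exact: weakly_null0|exists 0 => i; rewrite normr0].
- move=> y z [y0 [c yc]] [z0 [d zd]]; split; first exact: weakly_nullB.
  by exists (c + d) => i; rewrite (le_trans (ler_normB _ _)) // lerD.
- move=> t y [y0 [c yc]]; split; first exact: weakly_nullZ.
  by exists (`|t| * c) => i; rewrite normrZ ler_wpM2l.
- move=> u r y r0 uZ yu; split.
    by apply: (weakly_null_lim r0 _ yu) => n; exact: (uZ n).1.
  have [_ [c uc]] := uZ 0%N; exists (r 0%N + c) => i.
  by rewrite -[y i](subrK (u 0%N i)) (le_trans (ler_normD _ _)) // lerD.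
- by move=> C C' y CC'; apply: largeS => f; exact: upper_estimateS.
- move=> C C' y z yC zC; apply: largeS (largeI U_ultra yC zC) => f [].
  exact: upper_estimateB.
- by move=> C t y t0; apply: largeS => f; exact: upper_estimateZ.
- by move=> y [y0 [c yc]]; exact: large_estimate_finite S y0 yc.
- have [C HC] := large_estimate_sum B0; exists C => w y _ _; exact: HC.
exists C => x x1 x0.
have L : large_estimate C x.
  by apply: HC => [|i]; [split => //; exists 1 => i|]; rewrite x1.
have [h hi hP] := large_subsequences U_ultra U_free L.
by exists h; split => //; exact: (hP id).
Qed.

End uniformity.

Theorem theorem1p2 (R : realType) (W : completeNormedModType R) (v : nat -> W)
    (v_basic : basic_sequence v) (v_normalized : normalized v)
    (X : completeNormedModType R) :
  property_S X v <-> property_U X v.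
Proof.
split; last first.
  by move=> [C H] x x1 x0; have [f [fi fC]] := H x x1 x0; exists f; split => //; exists C.
have [K K0 K_coord] := basis_constant v_basic v_normalized.
(* An ultrafilter refining the eventual filter is free. *)
have [U [U_ultra Ufree]] := ultraFilterLemma (@eventually_filter).
apply: (property_S_U K0 K_coord U_ultra) => n; apply: Ufree.
by exists n.
Qed.
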